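(* Let $C \subseteq \mathbb{R}^n$ be a closed convex cone which is not a subspace, let $B$ be a convex cone which lies in $\mathrm{rbd}\, C$, and let $D$ be the orthogonal complement of $B$ in $C^\circ$: \[ D = \{ x \in C^\circ : x \cdot u = 0 \ \ \forall\, u \in B \}. \] The following assertions hold. (a) $D$ is a closed convex cone. (b) If $B \subseteq \mathrm{lin}\, C$, then $D = C^\circ$, and if $B \not\subseteq \mathrm{lin}\, C$, then $D$ lies in $\mathrm{rbd}\, C^\circ$ but not in $\mathrm{lin}\, C^\circ$. (c) There is an $(n - 1)$-dimensional subspace $S \subseteq \mathbb{R}^n$ containing $B$ and separating $C$ and $D$ such that $\mathrm{rint}\, C$ and $\mathrm{rint}\, D$ lie in the opposite open halfspaces of $\mathbb{R}^n$ determined by $S$.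
   Context: $\mathbb{R}^n$ carries the standard dot product $x\cdot y$; ''subspace'' means linear subspace. A nonempty convex set $C$ is a convex cone if $\lambda x\in C$ whenever $\lambda\geqslant 0$ and $x\in C$ (so the origin belongs to $C$). The (negative) polar set of a nonempty set $X\subseteq\mathbb{R}^n$ is $X^\circ=\{x\in\mathbb{R}^n: x\cdot e\leqslant 0\ \ \forall\, e\in X\}$. For a closed convex cone $C$, $\mathrm{lin}\, C=C\cap(-C)$ is its lineality space (the largest subspace contained in $C$). For a convex set $F$, $\mathrm{rint}\, F$ and $\mathrm{rbd}\, F$ are its relative interior and relative boundary (taken with respect to the affine hull of $F$). A hyperplane $S$ separates two sets if they lie in opposite closed halfspaces determined by $S$. *)

(* Defs.v *)
From HB Require Import structures.
From mathcomp Require Import all_boot all_order all_algebra.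
From mathcomp Require Import all_classical all_reals all_analysis.

Set Implicit Arguments.
Unset Strict Implicit.
Unset Printing Implicit Defensive.

Import Order.TTheory GRing.Theory Num.Theory.
Import numFieldNormedType.Exports.

Local Open Scope classical_set_scope.
Local Open Scope ring_scope.

(* 'rV[R]_n carries the library's max-norm topology, which is the usual
   topology of R^n; the Euclidean structure enters only through dotv. *)

Definition dotv (R : realType) (n : nat) (x y : 'rV[R]_n) : R :=
  \sum_(i < n) x 0 i * y 0 i.

Definition is_subspace (R : realType) (n : nat) (A : set 'rV[R]_n) : Prop :=
  exists U : {vspace 'rV[R]_n}, A = [set x | x \in U].

Definition convex_cone (R : realType) (n : nat) (C : set 'rV[R]_n) : Prop :=
  [/\ C !=set0, convex_set C &
      forall (t : R) (x : 'rV[R]_n), 0 <= t -> C x -> C (t *: x)].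

Definition polar (R : realType) (n : nat) (X : set 'rV[R]_n) :
    set 'rV[R]_n :=
  [set x | forall e, X e -> dotv x e <= 0].

Definition lineality (R : realType) (n : nat) (C : set 'rV[R]_n) :
    set 'rV[R]_n :=
  C `&` [set - x | x in C].

Definition ortho_in (R : realType) (n : nat) (K B : set 'rV[R]_n) :
    set 'rV[R]_n :=
  [set x | K x /\ forall u, B u -> dotv x u = 0].

Definition affine_set (R : realType) (n : nat) (A : set 'rV[R]_n) : Prop :=
  forall (x y : 'rV[R]_n) (t : R), A x -> A y -> A ((1 - t) *: x + t *: y).

Definition affine_hull (R : realType) (n : nat) (F : set 'rV[R]_n) :
    set 'rV[R]_n :=
  smallest (@affine_set R n) F.

Definition rint (R : realType) (n : nat) (F : set 'rV[R]_n) :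
    set 'rV[R]_n :=
  [set x | F x /\ \forall y \near x, affine_hull F y -> F y].

(* The affine hull is closed in R^n, so the closure of F relative to it is
   the closure of F in R^n. *)
Definition rbd (R : realType) (n : nat) (F : set 'rV[R]_n) :
    set 'rV[R]_n :=
  closure F `\` rint F.

Definition hyperplane (R : realType) (n : nat) (e : 'rV[R]_n) (c : R) :
    set 'rV[R]_n :=
  [set x | dotv x e = c].

Definition separates (R : realType) (n : nat) (S X Y : set 'rV[R]_n) : Prop :=
  exists (e : 'rV[R]_n) (c : R),
    [/\ e != 0, S = hyperplane e c,
        X `<=` [set x | dotv x e <= c] & Y `<=` [set y | c <= dotv y e]].

Definition in_opposite_open_halfspaces (R : realType) (n : nat)
    (S X Y : set 'rV[R]_n) : Prop :=
  exists (e : 'rV[R]_n) (c : R),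
    [/\ e != 0, S = hyperplane e c,
        X `<=` [set x | dotv x e < c] & Y `<=` [set y | c < dotv y e]].

(* Main.v *)
(* Every point b of rbd C admits a normal q in C° with q.b = 0 that is not
   orthogonal to C: otherwise q.b is bounded away from 0 over the unit vectors
   q of C° lying in span C (represented here by the closed set C^perp^perp),
   and the Moreau decomposition shows that every point of span C near b is
   in C.  Taking b relatively interior to B forces q.u = 0 for all u in B, so
   q is in D but -q is not in C°.  For the hyperplane, let p be the projection
   of -q onto D.  Then e = q + p belongs to D and, by Moreau, has nonnegative
   product with D; since q and p are in C° and q is not orthogonal to C, the
   vector e is also not orthogonal to C, and S is its orthogonal complement. *)

Require Import Defs.
From HB Require Import structures.
From mathcomp Require Import all_boot all_order all_algebra.
From mathcomp Require Import all_classical all_reals all_analysis.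
From mathcomp Require Import ring lra.

Import Order.TTheory GRing.Theory Num.Theory.
Import numFieldNormedType.Exports.

Local Open Scope classical_set_scope.
Local Open Scope ring_scope.

(** * Algebra and topology of the dot product, polars and convex cones *)

Section ConvexCones.
Context {R : realType} {n : nat}.
Implicit Types (x y z q : 'rV[R]_n) (C F : set 'rV[R]_n).

Lemma dotvC x y : dotv x y = dotv y x.
Proof. by apply: eq_bigr => i _; rewrite mulrC. Qed.

Lemma dotvDl x y z : dotv (x + y) z = dotv x z + dotv y z.
Proof. by rewrite -big_split; apply: eq_bigr => i _; rewrite mxE mulrDl. Qed.

Lemma dotvZl t x z : dotv (t *: x) z = t * dotv x z.
Proof. by rewrite mulr_sumr; apply: eq_bigr => i _; rewrite mxE mulrA. Qed.

Lemma dotvNl x z : dotv (- x) z = - dotv x z.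
Proof. by rewrite -scaleN1r dotvZl mulN1r. Qed.

Lemma dotvDr x y z : dotv z (x + y) = dotv z x + dotv z y.
Proof. by rewrite dotvC dotvDl !(dotvC z). Qed.

Lemma dotvZr t x z : dotv z (t *: x) = t * dotv z x.
Proof. by rewrite dotvC dotvZl dotvC. Qed.

Lemma dotvNr x z : dotv z (- x) = - dotv z x.
Proof. by rewrite dotvC dotvNl dotvC. Qed.

Definition dotvE := (dotvDl, dotvDr, dotvNl, dotvNr, dotvZl, dotvZr).

Lemma dotv0l x : dotv 0 x = 0.
Proof. by rewrite -(scale0r 0) dotvZl mul0r. Qed.

Lemma dotv_ge0 x : 0 <= dotv x x.
Proof. by apply: sumr_ge0 => i _; rewrite -expr2 sqr_ge0. Qed.

Lemma sqr_coord_le_dotv x i : x 0 i ^+ 2 <= dotv x x.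
Proof.
rewrite /dotv (bigD1 i) //= -expr2 lerDl.
by apply: sumr_ge0 => j _; rewrite -expr2 sqr_ge0.
Qed.

Lemma dotv_gt0 x : (0 < dotv x x) = (x != 0).
Proof.
rewrite lt0r dotv_ge0 andbT; congr negb; apply/eqP/eqP => [x0|->].
  apply/rowP => i; rewrite mxE; apply/eqP; rewrite -sqrf_eq0 eq_le sqr_ge0.
  by rewrite -x0 sqr_coord_le_dotv.
by rewrite dotv0l.
Qed.

Lemma dotv_continuous (T : topologicalType) (f g : T -> 'rV[R]_n) :
  continuous f -> continuous g -> continuous (fun t => dotv (f t) (g t)).
Proof.
move=> cf cg t; apply: cvg_big => [|i _]; first exact: add_continuous.
have coord h :
    continuous h -> {for t, continuous (fun s => (h s : 'rV[R]_n) 0 i)}.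
  move=> ch.
  exact: (@continuous_comp _ _ _ h (fun v => v 0 i) t (ch t)
    (@coord_continuous _ _ _ _ _ _)).
exact: (cvgM (coord _ cf) (coord _ cg)).
Qed.

Lemma dotvl_continuous z : continuous (fun x => dotv x z).
Proof.
apply: (@dotv_continuous _ id (fun=> z)); first by move=> x; exact: cvg_id.
exact: cst_continuous.
Qed.

Lemma dotv_dist_continuous z : continuous (fun x => dotv (x - z) (x - z)).
Proof.
have c : continuous (fun x => x - z).
  move=> x; apply: (@continuousB _ _ _ id (fun=> z) x); first exact: cvg_id.
  exact: cst_continuous.
by apply: (@dotv_continuous _ (fun x => x - z) (fun x => x - z)).
Qed.

Lemma dotv_bounded_compact (A : set 'rV[R]_n) (M : R) :
  closed A -> (forall x, A x -> dotv x x <= M) -> compact A.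
Proof.
move=> clA AM.
(* The half-width [M + 1] avoids a square root: [a ^+ 2 <= M] forces [a] between [- (M + 1)] and
   [M + 1]. *)
apply: (@subclosed_compact _ A
  [set v : 'rV[R]_n | forall i, `[- (M + 1), M + 1]%classic (v ord0 i)]) => //.
  apply: (@rV_compact _ _ (fun=> `[- (M + 1), M + 1]%classic)) => _.
  exact: segment_compact.
move=> x /AM xM i; rewrite /= in_itv /=.
have := le_trans (sqr_coord_le_dotv x i) xM.
set a := x _ _ => aM; apply/andP; split; nra.
Qed.

Lemma closed_dotv_le z : closed [set x | dotv x z <= 0].
Proof.
apply: (@preimage_closed _ _ (fun x => dotv x z) [set r | r <= 0]);
  last exact: closed_le.
by move=> x _; exact: dotvl_continuous.
Qed.

Lemma closed_dotv_eq z (c : R) : closed [set x | dotv x z = c].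
Proof.
apply: (@preimage_closed _ _ (fun x => dotv x z) [set r | r = c]);
  last exact: closed_eq.
by move=> x _; exact: dotvl_continuous.
Qed.

Lemma closed_polar C : closed (polar C).
Proof.
rewrite (_ : polar C = \bigcap_(e in C) [set x | dotv x e <= 0]).
  by apply: closed_bigI => e _; exact: closed_dotv_le.
by apply/seteqP; split.
Qed.

(* For a cone C, ortho (ortho C) is span C, in a form that is visibly closed. *)
Definition ortho C : set 'rV[R]_n := [set x | forall u, C u -> dotv x u = 0].

Lemma closed_ortho C : closed (ortho C).
Proof.
rewrite (_ : ortho C = \bigcap_(e in C) [set x | dotv x e = 0]).
  by apply: closed_bigI => e _; exact: closed_dotv_eq.
by apply/seteqP; split.
Qed.

Lemma linealityP C x : lineality C x <-> C x /\ C (- x).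
Proof.
split=> [[Cx [y Cy yx]]|[Cx CNx]]; first by rewrite -{2}yx opprK.
by split=> //; exists (- x) => //; rewrite opprK.
Qed.

(** A sum is twice a midpoint, so convexity and scaling give additivity; conversely a convex
    combination is a sum of nonnegative multiples. *)
Lemma convex_coneP C :
  convex_cone C <->
  [/\ C 0, forall x y, C x -> C y -> C (x + y) &
      forall (t : R) x, 0 <= t -> C x -> C (t *: x)].
Proof.
split=> [[[x Cx] cC sC]|[C0 aC sC]].
  split=> //; first by rewrite -(scale0r x); exact: sC.
  move=> u v Cu Cv.
  have h : 0 <= (2^-1 : R) <= 1 by lra.
  have := cC u v (@Itv01 R _ (proj1 (andP h)) (proj2 (andP h))).
  rewrite !inE => /(_ Cu Cv) /(sC 2 _ (ler0n _ _)).
  congr (C _).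
  change (2 *: (2^-1 *: u + (1 - 2^-1) *: v) = u + v).
  by rewrite scalerDr !scalerA mulrBr mulr1 divff ?pnatr_eq0// scale1r
     (_ : 2 - 1 = 1 :> R) ?scale1r//; lra.
split=> //; first by exists 0.
move=> u v l; rewrite !inE => Cu Cv; apply: aC; apply: sC => //.
by rewrite subr_ge0.
Qed.

End ConvexCones.

(** * Projection onto a closed convex cone and supporting normals *)

Section MoreauProjection.
Context {R : realType} {n : nat}.
Implicit Types (x y z q : 'rV[R]_n) (C F : set 'rV[R]_n).

(** First-order optimality for a quadratic, already divided by [t]. If [a < 0], the choice
    [t = - a / (b + 1 - a)] gives [t * b <= - a], hence [2 * a + t * b <= a < 0]. *)
Lemma ge0_of_small_quadratic (a b : R) : 0 <= b ->
  (forall t, 0 < t -> t <= 1 -> 0 <= 2 * a + t * b) -> 0 <= a.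
Proof.
move=> b0 h; rewrite leNgt; apply/negP => a0.
have d0 : 0 < b + 1 - a by lra.
have t0 : 0 < - a / (b + 1 - a) by rewrite divr_gt0 // oppr_gt0.
have t1 : - a / (b + 1 - a) <= 1 by rewrite ler_pdivrMr //; lra.
have : - a / (b + 1 - a) * b <= - a.
  by rewrite mulrAC ler_pdivrMr //; nra.
by have := h _ t0 t1; lra.
Qed.

(** Here [p] is the point of [C] nearest to [y]; it exists because only the compact part [K] of [C],
    no farther from [y] than the origin, matters. Moving from [p] to [p + t *: c] gives polarity,
    and shrinking [p] to [(1 - t) *: p] gives orthogonality. *)
Lemma moreau C y : closed C -> convex_cone C ->
  exists p, [/\ C p, polar C (y - p) & dotv (y - p) p = 0].
Proof.
move=> clC /convex_coneP[C0 aC sC].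
pose f x := dotv (x - y) (x - y).
pose K := C `&` [set x | f x <= dotv y y].
have cf : continuous f by exact: dotv_dist_continuous.
have cK : compact K.
  (* Membership in [K] says [x.x <= 2 x.y]; combined with [0 <= |x - 2y|^2] this yields
     [x.x <= 4 y.y]. *)
  apply: (@dotv_bounded_compact _ _ _ (4 * dotv y y)).
    apply: closedI => //.
    apply: (@preimage_closed _ _ f [set r | r <= dotv y y]).
      by move=> x _; exact: cf.
    exact: closed_le.
  move=> x [_]; rewrite /f /= !dotvE (dotvC y x) => h.
  by have := dotv_ge0 (x - 2 *: y); rewrite !dotvE (dotvC y x); lra.
have K0 : K !=set0 by exists 0; split=> //; rewrite /= /f sub0r !dotvE opprK.
have [|p pK minp] := @compact_EVT_min _ _ f K K0 cK.
  exact: continuous_subspaceT.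
move: pK; rewrite inE => -[Cp /= fp].
have {}minp c : C c -> f p <= f c.
  move=> Cc; have [fc|/ltW fc] := leP (f c) (dotv y y).
    by apply: minp; rewrite inE; split.
  exact: le_trans fc.
have q_le c : C c -> dotv (y - p) c <= 0.
  move=> Cc; rewrite -oppr_ge0; apply: (@ge0_of_small_quadratic _ (dotv c c)).
    exact: dotv_ge0.
  move=> t t0 _; have := minp _ (aC _ _ Cp (sC _ _ (ltW t0) Cc)).
  rewrite /f !dotvE (dotvC c p) (dotvC y p) (dotvC c y) => h.
  by rewrite -(pmulr_rge0 _ t0); lra.
exists p; split=> //; apply/eqP; rewrite eq_le q_le //=.
apply: (@ge0_of_small_quadratic _ (dotv p p)); first exact: dotv_ge0.
move=> t t0 t1.
have := minp _ (sC _ _ _ Cp : C ((1 - t) *: p)); rewrite subr_ge0 => /(_ t1).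
rewrite /f !dotvE (dotvC y p) => h.
by rewrite -(pmulr_rge0 _ t0); lra.
Qed.

Lemma polar_sep C y : closed C -> convex_cone C -> ~ C y ->
  exists p, [/\ C p, polar C (y - p), dotv (y - p) p = 0 &
                0 < dotv (y - p) (y - p)].
Proof.
move=> clC cC nCy; have [p [Cp pol ort]] := moreau C y clC cC.
exists p; split=> //; rewrite dotv_gt0 subr_eq0.
by apply/eqP => yp; apply: nCy; rewrite yp.
Qed.

(** The segment from [c] to [x] can be prolonged past [x]: the new point is the affine combination
    of [x] and [c] with weight [- t] on [c], and for small [t] it is near [x]. *)
Lemma rint_extend F x c : rint F x -> F c ->
  exists2 t, 0 < t & F (x + t *: (x - c)).
Proof.
move=> [Fx Fnear] Fc.
have cont : continuous (fun t : R => x + t *: (x - c)).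
  move=> t; apply: cvgD; first exact: cvg_cst.
  by apply: cvgZr_tmp; exact: cvg_id.
have := cont 0; rewrite /continuous_at scale0r addr0 => /(_ _ Fnear) near0.
have [t [t0 Ft]] : exists t : R, 0 < t /\
    (affine_hull F (x + t *: (x - c)) -> F (x + t *: (x - c))).
  near (0 : R)^'+ => t; exists t; split=> //.
  by near: t; exact: cvg_at_right_filter near0.
exists t => //; apply: Ft => A [affA FA].
have := affA x c (- t) (FA _ Fx) (FA _ Fc).
congr (A _); rewrite opprK scalerDl scale1r scalerBr scaleNr.
by rewrite addrA.
Unshelve. all: by end_near. Qed.

(** If the form vanished at [x], it would be positive just past [x] on the line coming from [c]. *)
Lemma rint_dotv_lt0 F e x : (forall y, F y -> dotv y e <= 0) ->
  (exists2 c, F c & dotv c e < 0) -> rint F x -> dotv x e < 0.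
Proof.
move=> Fe [c Fc ce] rx; rewrite lt_neqAle Fe ?andbT; last by case: rx.
apply/eqP => xe; have [t t0 Ft] := rint_extend F x c rx Fc.
by have := Fe _ Ft; rewrite !dotvE xe; nra.
Qed.

Lemma support_rbd C b : closed C -> convex_cone C -> rbd C b ->
  exists q, [/\ polar C q, dotv q b = 0 & ~ ortho C q].
Proof.
move=> clC cC [/clC Cb nrb]; apply: contrapT => noq; apply: nrb.
have [C0 aC sC] := (convex_coneP C).1 cC.
have affW y : affine_hull C y -> ortho (ortho C) y.
  apply; split=> [u v t Wu Wv w ow|c Cc u /(_ _ Cc)]; last by rewrite dotvC.
  by rewrite !dotvE Wu // Wv // !mulr0 addr0.
have ortho_self q : ortho C q -> ortho (ortho C) q -> dotv q q = 0.
  by move=> oq /(_ _ oq).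
pose K := polar C `&` (ortho (ortho C) `&` [set q | dotv q q = 1]).
(* The separating [q] is the normalized Moreau residual of [y]; it stays in the span because [y] and
   its projection both lie there. *)
have sep y : ortho (ortho C) y -> ~ C y -> exists2 q, K q & 0 < dotv q y.
  move=> Wy nCy; have [p [Cp pol ort q0]] := polar_sep C y clC cC nCy.
  have [q qE] : exists q, q = y - p by exists (y - p).
  rewrite -qE in pol ort q0; set s := Num.sqrt (dotv q q).
  have s0 : 0 < s by rewrite sqrtr_gt0.
  have ss : s * s = dotv q q by rewrite -expr2 sqr_sqrtr // ltW.
  exists (s^-1 *: q).
    split; [|split].
    - by move=> c Cc; rewrite dotvE pmulr_rle0 ?invr_gt0 //; exact: pol.
    - move=> u ou; rewrite qE !dotvE Wy // (dotvC p) ou // subrr mulr0 //.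
    - by rewrite /= !dotvE -ss; field; rewrite gt_eqF.
  rewrite dotvE pmulr_rgt0 ?invr_gt0 //.
  by rewrite -(subrK p y) -qE dotvDr ort addr0.
split=> //.
(* With [K] empty nothing can be separated, so [C] contains its whole affine hull. *)
have [[q0 Kq0]|K0] := pselect (K !=set0); last first.
  apply: (@filterE _ (nbhs b) _) => y /affW Wy.
  apply: contrapT => /(sep _ Wy)[q Kq _].
  by apply: K0; exists q.
have cK : compact K.
  apply: (@dotv_bounded_compact _ _ _ 1); last by move=> x [_ [_ ->]].
  apply: closedI; first exact: closed_polar.
  apply: closedI; first exact: closed_ortho.
  apply: (@preimage_closed _ _ (fun q => dotv q q) [set r | r = 1]).
    move=> x _; have := @dotv_dist_continuous R n 0 x.
    by under eq_fun do rewrite subr0.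
  exact: closed_eq.
have [||m mK maxm] := @compact_EVT_max _ _ (fun q => dotv q b) K _ cK.
- by exists q0.
- by apply: continuous_subspaceT; exact: dotvl_continuous.
move: mK; rewrite inE => -[pm [Wm m1]].
(* If [m.b = 0], then [noq] puts [m] in [ortho C]; lying also in the span, [m] would be orthogonal
   to itself, although [m.m = 1]. *)
have mb : dotv m b < 0.
  rewrite lt_neqAle pm // andbT; apply/eqP => mb; apply: noq; exists m.
  split=> // om; have := ortho_self _ om Wm; rewrite m1.
  by move/eqP; rewrite oner_eq0.
(* On the ball of radius [- m.b] around [b], every unit [q] with [q.b <= m.b] stays negative, so no
   element of [K] separates [y] from [C]. *)
have : \forall y \near b, dotv (y - b) (y - b) < (dotv m b) ^+ 2.
  have := @dotv_dist_continuous R n b b.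
  rewrite /continuous_at subrr dotv0l => /(_ [set r | r < (dotv m b) ^+ 2]).
  by apply; apply: lt_nbhsl; rewrite exprn_even_gt0 //= lt_eqF.
apply: (@filterS _ (nbhs b) _) => y yb /affW Wy.
apply: contrapT => /(sep _ Wy)[q Kq qy].
have qb : dotv q b <= dotv m b by apply: maxm; rewrite inE.
(* Cauchy-Schwarz in the form [2 q.z <= s + (z.z) / s], with [s = - m.b] *)
have := dotv_ge0 (- dotv m b *: q - (y - b)).
have q1 : dotv q q = 1 by case: Kq => _ [].
move: yb qy; rewrite -[in dotv q y](subrK b y) ![dotv q (_ + b)]dotvDr.
move: (y - b) => z zz qz.
rewrite !dotvE q1 (dotvC z q).
nra.
Qed.

End MoreauProjection.

(** * Generic points of cones, and hyperplanes as subspaces *)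

Section GenericPoint.
Context {R : realType} {n : nat}.
Implicit Types (B C : set 'rV[R]_n).

Lemma dim_rV : dim 'rV[R]_n = n.
Proof. exact: mul1n. Qed.

(** Elements of [B] outside the current span are added one at a time; [k] bounds the codimension
    still available. *)
Lemma finite_spanning_seq B : exists s : seq 'rV[R]_n,
  (forall x, x \in s -> B x) /\ forall u, B u -> u \in span s.
Proof.
suff ext k s : (n <= \dim (span s) + k)%N -> (forall x, x \in s -> B x) ->
    exists s : seq 'rV[R]_n,
      (forall x, x \in s -> B x) /\ forall u, B u -> u \in span s.
  exact: (ext n [::] (leq_addl _ _)).
elim: k s => [|k IHk] s dims sB.
  exists s; split=> // u _; suff /eqP -> : span s == fullv by rewrite memvf.
  by rewrite eqEdim subvf dimvf dim_rV (leq_trans dims) ?addn0.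
have [sp|/existsNP[u /not_implyP[Bu nu]]] :=
  pselect (forall u, B u -> u \in span s); first by exists s.
apply: (IHk (u :: s)) => [|x]; last first.
  by rewrite inE => /orP[/eqP ->|/sB].
apply: leq_trans dims _; rewrite addnS -addSn leq_add2r ltnNge.
apply/negP => dimu; apply: nu.
have /eqP -> : span s == span (u :: s).
  by rewrite eqEdim dimu andbT; apply: sub_span => x xs; rewrite inE xs orbT.
by rewrite memv_span // mem_head.
Qed.

(* An algebraic form of the nonemptiness of the relative interior of [B]. *)
Lemma cone_generic_point B : convex_cone B ->
  exists2 b, B b & forall u, B u -> exists2 t, 0 < t & B (b - t *: u).
Proof.
move=> /convex_coneP[B0 aB sB]; have [s [ss sp]] := finite_spanning_seq B.
have si (i : 'I_(size s)) : B s`_i by apply/ss/mem_nth.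
(* Writing [u] as the sum of the [c i *: s_i], the point [b - t *: u] is the sum of the
   [(1 - t * c i) *: s_i]; [t = (1 + M)^-1] makes all these coefficients nonnegative. *)
exists (\sum_(i < size s) s`_i); first by apply: (big_ind B).
move=> u /sp /(@coord_span _ _ _ (in_tuple s)) ->.
pose c i := coord (in_tuple s) i u; pose M := \sum_i `|c i|.
have M0 : 0 < 1 + M by rewrite ltr_wpDr // sumr_ge0.
exists (1 + M)^-1; first by rewrite invr_gt0.
rewrite scaler_sumr -sumrB; apply: (big_ind B) => // i _.
rewrite scalerA -[X in X - _]scale1r -scalerBl; apply: sB => //.
rewrite -/(c i) subr_ge0 mulrC ler_pdivrMr // mul1r.
apply: le_trans (ler_norm _) _; rewrite /M (bigD1 i) //= addrCA lerDl.
by rewrite addr_ge0 // sumr_ge0.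
Qed.

(** A normal [q] at a generic point [b] of [B] has [q.u <= 0] on [B], while [b - t *: u] in [C] with
    [q.b = 0] forces [q.u >= 0]. *)
Lemma support_cone_rbd B C : closed C -> convex_cone C -> convex_cone B ->
  B `<=` rbd C -> exists2 q, ortho_in (polar C) B q & ~ ortho C q.
Proof.
move=> clC cC cB BC; have [b Bb bgen] := cone_generic_point B cB.
have [q [pq qb nq]] := support_rbd C b clC cC (BC _ Bb).
exists q => //; split=> // u Bu.
have BsubC v : B v -> C v by move=> /BC[/clC].
apply/eqP; rewrite eq_le pq /=; last exact: BsubC.
have [t t0 /BsubC /pq] := bgen _ Bu.
by rewrite !dotvE qb add0r oppr_le0 pmulr_rge0.
Qed.

(** Rank-nullity for the form [x |-> x.e], which is nonzero at [e] and so has rank one. *)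
Lemma ortho_hyperplane (e : 'rV[R]_n) : e != 0 ->
  exists2 S : {vspace 'rV[R]_n},
    \dim S = (n - 1)%N & [set x | x \in S] = hyperplane e 0.
Proof.
move=> e0; pose f := linfun (mulmxr e^T : 'rV[R]_n -> 'rV[R]_1).
have fE x : f x = (dotv x e)%:M.
  rewrite lfunE /=; apply/rowP => i; rewrite ord1 !mxE eqxx mulr1n.
  by apply: eq_bigr => j _; rewrite mxE.
exists (lker f); last first.
  apply/seteqP; split=> x /=; rewrite memv_ker fE /hyperplane /=.
    by move=> /eqP/rowP/(_ 0); rewrite !mxE eqxx mulr1n.
  by move=> ->; rewrite raddf0.
have := limg_ker_dim f fullv; rewrite capfv dimvf dim_rV => dimE.
suff img1 : \dim (limg f) = 1%N by rewrite -[X in (X - 1)%N]dimE img1 addnK.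
apply/eqP; rewrite eqn_leq; apply/andP; split.
  by apply: leq_trans (dimvS (subvf _)) _; rewrite dimvf.
rewrite lt0n dimv_eq0; apply/negP => /eqP f0.
have : f e \in limg f by rewrite memv_img // memvf.
rewrite f0 memv0 fE => /eqP/rowP/(_ 0); rewrite !mxE eqxx mulr1n => /eqP.
by rewrite gt_eqF // dotv_gt0.
Qed.

End GenericPoint.

Theorem theorem3p1 (R : realType) (n : nat) (C B D : set 'rV[R]_n)
    (C_closed : closed C) (C_cone : convex_cone C)
    (C_not_subspace : ~ is_subspace C)
    (B_cone : convex_cone B) (B_rbd : B `<=` rbd C)
    (D_def : D = ortho_in (polar C) B) :
  [/\ closed D /\ convex_cone D,
      (B `<=` lineality C -> D = polar C) /\
      (~ (B `<=` lineality C) ->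
         D `<=` rbd (polar C) /\ ~ (D `<=` lineality (polar C))) &
      exists S : {vspace 'rV[R]_n},
        [/\ \dim S = (n - 1)%N,
            B `<=` [set x | x \in S],
            separates [set x | x \in S] C D &
            in_opposite_open_halfspaces [set x | x \in S] (rint C) (rint D)]].
Proof.
have BC u : B u -> C u by move=> /B_rbd[/C_closed].
have D_closed : closed D.
  by rewrite D_def; apply: closedI; [exact: closed_polar|exact: closed_ortho].
have D_cone : convex_cone D.
  rewrite D_def; apply/convex_coneP; split.
  - by split=> u _; rewrite dotv0l.
  - move=> x y [px ox] [py oy]; split=> u uX; rewrite dotvE.
      by rewrite -(addr0 0) lerD ?px ?py.
    by rewrite ox // oy // addr0.
  - move=> t x t0 [px ox]; split=> u uX; rewrite dotvE.
      by rewrite mulr_ge0_le0 // px.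
    by rewrite ox // mulr0.
have [q Dq /existsNP[c /not_implyP[Cc qc]]] :=
  support_cone_rbd B C C_closed C_cone B_cone B_rbd.
have {}qc : dotv q c < 0.
  by rewrite lt_neqAle (proj1 Dq c Cc) andbT; exact/eqP.
have {}Dq : D q by rewrite D_def.
split=> //.
- split=> [Blin|].
    rewrite D_def; apply/seteqP; split=> [x []//|x px]; split=> // u.
    move=> /Blin /linealityP[Cu CNu]; apply/eqP; rewrite eq_le px //=.
    by have := px _ CNu; rewrite dotvE oppr_le0.
  move=> /existsNP[u /not_implyP[Bu nu]]; split=> [x Dx|Dlin].
    have [px xu] : polar C x /\ dotv x u = 0.
      by move: Dx; rewrite D_def => -[px ox]; split=> //; exact: ox.
    split; first exact: subset_closure.
    (* If [- u] were outside [C], its Moreau residual [r] would lie in the polar with [r.u < 0].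
       Prolonging past [x] from [r] would give a point of the polar with positive product with [u],
       since [x.u = 0]. *)
    move=> rx; apply: nu; apply/linealityP; split; first exact: BC.
    apply: contrapT => nCu.
    have [p [Cp py yp y0]] := polar_sep C (- u) C_closed C_cone nCu.
    have [t t0] := rint_extend (polar C) x _ rx py.
    move=> /(_ _ (BC _ Bu)); rewrite dotvDl dotvZl dotvDl dotvNl xu.
    have : dotv (- u - p) u < 0.
      by move: y0; rewrite dotvDr !dotvNr yp oppr0 addr0 oppr_gt0.
    by nra.
  have /linealityP[_ /(_ _ Cc)] := Dlin _ Dq.
  by rewrite dotvE oppr_le0 leNgt qc.
have [p [Dp pol ort]] := moreau D (- q) D_closed D_cone.
have De : D (q + p) by have /convex_coneP[_ + _] := D_cone; apply.
have eD y : D y -> 0 <= dotv y (q + p).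
  by move=> /pol; rewrite dotvC -opprD dotvNr oppr_le0.
have [eC eB] : polar C (q + p) /\ forall u, B u -> dotv (q + p) u = 0.
  by move: De; rewrite D_def.
have ec : dotv c (q + p) < 0.
  rewrite dotvC dotvDl -(addr0 0) ltr_leD //.
  by move: Dp; rewrite D_def => -[+ _]; apply.
have e0 : q + p != 0.
  by apply/eqP => e0; move: ec; rewrite e0 dotvC dotv0l ltxx.
have Ce x : C x -> dotv x (q + p) <= 0 by move=> /eC; rewrite dotvC.
have [S dimS SE] := ortho_hyperplane (q + p) e0.
exists S; split=> //.
- by rewrite SE => u /eB; rewrite dotvC.
- by exists (q + p), 0; split.
- exists (q + p), 0; split=> // x.
    by apply: rint_dotv_lt0 => //; exists c.
  (* On the side of [D] the point with strict inequality is the normal [q + p] itself. *)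
  rewrite /= => rx; rewrite -oppr_lt0 -dotvNr; apply: rint_dotv_lt0 rx.
    by move=> y /eD; rewrite dotvNr oppr_le0.
  by exists (q + p) => //; rewrite dotvNr oppr_lt0 dotv_gt0.
Qed.
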